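(* Let $T>0$, $\delta=\frac{T}{N}$ with $N\in\mathbb{N}$, $N\ge 1$, and let $h_v>0$, $h_x>0$ satisfy $h_x=\delta h_v$. Let $a>0$ and $\sigma\in[0,\sqrt a)$ be constants with $2\sigma^4<a^2$. Then the semi-implicit Milstein finite difference scheme described in the context is asymptotically mean-square stable: for every $(\xi,\eta)\in\left[-\frac{\pi}{h_x},\frac{\pi}{h_x}\right]\times\left[-\frac{\pi}{h_v},\frac{\pi}{h_v}\right]\setminus\{(0,0)\}$, $$\lim_{n\to+\infty}\mathbb{E}\left[|X^n(\xi,\eta)|^2\right]=0 .$$
   Context: The scheme approximates the degenerate Langevin SPDE $d_{\mathbf Y}u_t=\frac a2\partial_{vv}u_t\,dt+\sigma\,\partial_v u_t\,dW_t$, $\mathbf Y=\partial_t+v\partial_x$, with constant coefficients. Scheme. Grid functions are families $U=(U_{j,k})_{(j,k)\in\mathbb{Z}^2}$, where $U_{j,k}$ corresponds to the point $(x_j,v_k)=(jh_x,kh_v)$. Since $h_x=\delta h_v$, the shift $(x,v)\mapsto(x+\delta v,v)$ maps the grid to itself. Define $$(S_\delta U)_{j,k}=U_{j+k,k},\qquad (S_{-\delta}U)_{j,k}=U_{j-k,k},$$ $$(D_vU)_{j,k}=\frac{U_{j,k+1}-U_{j,k-1}}{2h_v},\qquad (D_{vv}U)_{j,k}=\frac{U_{j,k+1}-2U_{j,k}+U_{j,k-1}}{h_v^2},$$ and $K_1=aD_{vv}$, $K_2=\sigma D_v$, $K_3=\sigma^2D_v^2$ (with $D_v^2=D_v\circ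 D_v$). Let $Z_0,Z_1,\dots$ be independent standard normal random variables. The scheme is $$S_\delta U^{n+1}=U^n+\tfrac\delta2 S_\delta K_1U^{n+1}+\sqrt\delta\,Z_nK_2U^n+\tfrac\delta2(Z_n^2-1)K_3U^n,$$ equivalently $(I-\frac\delta2K_1)U^{n+1}=S_{-\delta}\big(I+\sqrt\delta Z_nK_2+\frac\delta2(Z_n^2-1)K_3\big)U^n$, where $U^{n+1}$ is the unique solution in $\ell^2(\mathbb{Z}^2)$, for $n=0,1,2,\dots$ (with $\delta,h_x,h_v$ fixed). The initial datum is the discrete Dirac mass at a grid point $(x_0,v_0)=(j_0h_x,k_0h_v)$: $U^0_{j,k}=h_x^{-1}h_v^{-1}$ if $(j,k)=(j_0,k_0)$ and $0$ otherwise. Fourier symbols. Set $$\hat U^n(\xi,\eta)=h_xh_v\sum_{j,k\in\mathbb{Z}}U^n_{j,k}\,e^{-i((j-j_0)h_x\xi+(k-k_0)h_v\eta)},\qquad(\xi,\eta)\in\mathbb{R}^2,$$ so that $\hat U^0\equiv1$. The random function $X^n$ is defined by $\hat U^n(\xi,\eta)=X^n(\xi,\eta+n\delta\xi)$ for all $(\xi,\eta)\in\mathbb{R}^2$. *)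

(* Defs.v *)
From HB Require Import structures.
From mathcomp Require Import all_boot all_order all_algebra.
From mathcomp Require Import finmap complex.
From mathcomp Require Import all_classical all_reals all_analysis.
From mathcomp.analysis.showcase Require Import summability.

Set Implicit Arguments.
Unset Strict Implicit.
Unset Printing Implicit Defensive.

Import Order.TTheory GRing.Theory Num.Theory.
Import numFieldNormedType.Exports.

Local Open Scope classical_set_scope.
Local Open Scope ring_scope.
Local Open Scope complex_scope.

Section Probability.
Context {d : measure_display} {Omega : measurableType d} {R : realType}.
Variable P : probability Omega R.

Definition mutually_independent (I : choiceType) (Z : I -> {RV P >-> R}) : Prop :=
  forall (J : {fset I}) (B : I -> set R),
    (forall i, measurable (B i)) ->
    P (\bigcap_(i in [set` J]) (Z i @^-1` B i)) =
      (\prod_(i <- J) P (Z i @^-1` B i))%E.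

Definition standard_normal (Z : {RV P >-> R}) : Prop :=
  forall B : set R, measurable B -> distribution P Z B = normal_prob 0 1 B.

End Probability.

Section Scheme.
Context {R : realType}.

(* [U j k] is the value at the point [(j * hx, k * hv)]. *)
Definition grid_fun : Type := int -> int -> R.

(* The shift (x, v) |-> (x + delta * v, v) on the grid, when hx = delta * hv. *)
Definition shift (U : grid_fun) : grid_fun := fun j k => U (j + k) k.

Definition Dv (hv : R) (U : grid_fun) : grid_fun :=
  fun j k => (U j (k + 1) - U j (k - 1)) / (2 * hv).

Definition Dvv (hv : R) (U : grid_fun) : grid_fun :=
  fun j k => (U j (k + 1) - 2 * U j k + U j (k - 1)) / hv ^+ 2.

Definition K1 (a hv : R) (U : grid_fun) : grid_fun :=
  fun j k => a * Dvv hv U j k.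

Definition K2 (sigma hv : R) (U : grid_fun) : grid_fun :=
  fun j k => sigma * Dv hv U j k.

Definition K3 (sigma hv : R) (U : grid_fun) : grid_fun :=
  fun j k => sigma ^+ 2 * Dv hv (Dv hv U) j k.

Definition in_l2 (U : grid_fun) : Prop :=
  (\esum_(p in [set: int * int]) ((U p.1 p.2) ^+ 2)%:E < +oo)%E.

Definition discrete_dirac (hx hv : R) (j0 k0 : int) : grid_fun :=
  fun j k => if (j == j0) && (k == k0) then hx^-1 * hv^-1 else 0.

(* One time step from [U] to [V], with [z] the value of the normal variable. *)
Definition milstein_step (a sigma delta hv z : R) (U V : grid_fun) : Prop :=
  forall j k : int,
    shift V j k =
      U j k + delta / 2 * shift (K1 a hv V) j k
      + Num.sqrt delta * z * K2 sigma hv U j k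
      + delta / 2 * (z ^+ 2 - 1) * K3 sigma hv U j k.

Definition milstein_scheme (a sigma delta hx hv : R) (j0 k0 : int)
    (z : nat -> R) (U : nat -> grid_fun) : Prop :=
  U 0%N = discrete_dirac hx hv j0 k0 /\
  forall n, in_l2 (U n.+1) /\ milstein_step a sigma delta hv (z n) (U n) (U n.+1).

(* exp(i * t) for a real t *)
Definition cis (t : R) : R[i] := cos t +i* sin t.

(* [summability.sum] is the limit over the net of finite subsets of the index
   type, i.e. the unconditional sum. *)
Definition Uhat (hx hv : R) (j0 k0 : int) (U : grid_fun) (xi eta : R) : R[i] :=
  (hx * hv)%:C *
  summability.sum (fun p : int * int =>
    (U p.1 p.2)%:C *
    cis (- ((p.1 - j0)%:~R * hx * xi + (p.2 - k0)%:~R * hv * eta)) : R[i]^o).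

End Scheme.

Arguments grid_fun : clear implicits.

(* Main.v *)
(** For fixed [xi] and [eta] put [theta_m = hv (eta - m delta xi)] and
    [c_m = delta (sigma sin theta_m / hv)^2].  Taking Fourier sums in the scheme
    gives [|X^n|^2 = prod_(m < n) gain (theta_m, Z_m) / damping (theta_(m+1))^2],
    where [damping theta = 1 + delta a (1 - cos theta) / hv^2] and
    [gain (theta_m, z) = 1 + c_m + c_m^2 (z^2 - 1)^2 / 4].  By independence and
    [E (Z^2 - 1)^2 <= 2], up to the constant [damping (theta_0)^2] the expectation
    is at most the product of the ratios
    [(1 + c_m + c_m^2 / 2) / damping (theta_m)^2], and the hypotheses on [sigma]
    and [a] bound each ratio by [1 - kappa (1 - cos theta_m)] with [kappa > 0].
    Two consecutive values of [1 - cos theta_m] cannot both be small, so the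
    product of any two consecutive factors is at most some [q < 1]. *)

Require Import Defs.
From HB Require Import structures.
From mathcomp Require Import all_boot all_order all_algebra.
From mathcomp Require Import finmap complex.
From mathcomp Require Import all_classical all_reals all_analysis.
From mathcomp Require Import measurable_realfun.
From mathcomp Require Import ring lra zify.
From mathcomp.analysis.showcase Require Import summability.

Set Implicit Arguments.
Unset Strict Implicit.
Unset Printing Implicit Defensive.

Import Order.TTheory GRing.Theory Num.Theory.
Import numFieldNormedType.Exports.

Local Open Scope classical_set_scope.
Local Open Scope ring_scope.
Local Open Scope complex_scope.

(** * Expectation of products of independent variables *)

Section ProductExpectation.
Import HBNNSimple.
Local Open Scope ereal_scope.

(** The hypothesis is the case of indicators; linearity gives simple functions and monotone
    convergence gives [g]. The weight [Y] is later the product of the remaining independent factors,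
    then the normal density with [Z = id], then the constant 1. *)
Lemma ge0_integral_comp_weight {d1 d2 : measure_display} {T1 : measurableType d1}
    {T2 : measurableType d2} {R : realType} (mu : {measure set T1 -> \bar R})
    (nu : {measure set T2 -> \bar R}) (Z : T1 -> T2) (Y : T1 -> R) (c : R)
    (g : T2 -> R) :
  measurable_fun setT Z -> measurable_fun setT Y -> measurable_fun setT g ->
  (forall x, 0 <= Y x)%R -> (forall x, 0 <= g x)%R ->
  (forall B, measurable B ->
     \int[mu]_x (Y x * \1_B (Z x))%:E = c%:E * nu B) ->
  \int[mu]_x (Y x * g (Z x))%:E = c%:E * \int[nu]_x (g x)%:E.
Proof.
move=> mZ mY mg Y0 g0 YB.
have mg' : measurable_fun [set: T2] (fun x => (g x)%:E) by exact/measurable_EFinP.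
pose g_ := nnsfun_approx measurableT mg'.
have gcvg x : (g_ n x)%:E @[n --> \oo] --> (g x)%:E.
  by apply: cvg_nnsfun_approx => // y _; rewrite lee_fin.
have mgZ n : measurable_fun setT (g_ n \o Z) by exact: measurableT_comp.
transitivity (limn (fun n => \int[mu]_x (Y x * g_ n (Z x))%:E)).
  rewrite -monotone_convergence//=.
  - apply: eq_integral => x _; apply/esym/cvg_lim => //.
    under eq_fun do rewrite EFinM.
    by rewrite EFinM; apply: cvgeZl.
  - by move=> n; apply/measurable_EFinP; apply: measurable_funM => //; exact: mgZ.
  - by move=> n x _; rewrite lee_fin mulr_ge0.
  - move=> x _ a b ab; rewrite lee_fin ler_wpM2l//.
    by move/lefP : (nd_nnsfun_approx measurableT mg' ab) => /(_ (Z x)).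
rewrite (_ : \int[nu]_x _ = limn (fun n => \int[nu]_x (g_ n x)%:E)); last first.
  rewrite -monotone_convergence//=.
  - apply: eq_integral => x _; apply/esym/cvg_lim => //; exact: gcvg.
  - by move=> n; exact/measurable_EFinP.
  - by move=> n x _; rewrite lee_fin.
  - by move=> x _ a b ab; rewrite lee_fin; exact/lefP/nd_nnsfun_approx.
rewrite -limeMl//; last first.
  apply/ereal_nondecreasing_is_cvgn => a b ab; apply: ge0_le_integral => //.
  - by move=> x _; rewrite lee_fin.
  - exact/measurable_EFinP.
  - exact/measurable_EFinP.
  - by move=> x _; rewrite lee_fin; exact/lefP/nd_nnsfun_approx.
congr (limn _); apply/funext => n /=.

(* The simple function [g_ n] is split over its level sets, to each of which [YB] applies. *)
transitivity (\sum_(r \in range (g_ n)) \int[mu]_x (r * (Y x * \1_(g_ n @^-1` [set r]) (Z x)))%:E).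
  rewrite -ge0_integral_fsum//; last 2 first.
  - move=> r; apply/measurable_EFinP/measurable_funM => //; apply: measurable_funM => //.
    by apply: measurableT_comp => //; exact: measurable_indic.
  - move=> r x _; rewrite lee_fin mulrCA mulr_ge0//.
    by have := nnfun_muleindic_ge0 (g_ n) r (Z x); rewrite -EFinM lee_fin.
  apply: eq_integral => x _; rewrite fimfunE fsumEFin//; congr (_%:E).
  rewrite !fsbig_finite//= mulr_sumr; apply: eq_bigr => r _.
  by rewrite mulrCA.
rewrite integralT_nnsfun sintegralE ge0_mule_fsumr//; last first.
  by move=> r; rewrite nnsfun_mulemu_ge0.
apply: eq_fsbigr => r; rewrite inE => -[y _ <-].
have gy0 : (0 <= g_ n y)%R by [].
under eq_integral do rewrite EFinM.
rewrite ge0_integralZl_EFin//; last 2 first.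
- by move=> x _; rewrite lee_fin mulr_ge0.
- apply/measurable_EFinP/measurable_funM => //.
  by apply: measurableT_comp => //; exact: measurable_indic.
by rewrite YB// muleCA.
Qed.

End ProductExpectation.

Section Independence.
Local Open Scope ereal_scope.
Context {d : measure_display} {Omega : measurableType d} {R : realType}.
Variable P : probability Omega R.
Variable Z : nat -> {RV P >-> R}.
Hypothesis Z_indep : mutually_independent Z.

(** A product of indicators is the indicator of an intersection, so independence applies with [J]
    the set of indices below [n]. This starts the induction that follows. *)
Let indep_indic (n : nat) (B : nat -> set R) : (forall i, measurable (B i)) ->
  \int[P]_w (\prod_(i < n) \1_(B i) (Z i w))%:E =
  (\prod_(i < n) fine (P (Z i @^-1` B i)))%:E.
Proof.
move=> mB.
pose J := seq_fset tt (iota 0 n).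
have inJ i : (i \in J) = (i < n)%N by rewrite seq_fsetE mem_iota add0n.
have mZB i : measurable (Z i @^-1` B i) by exact: measurable_sfunP.
transitivity (P (\bigcap_(i in [set` J]) (Z i @^-1` B i))).
  rewrite -[X in _ = P X]setIT -integral_indic//; last first.
    by apply: fin_bigcap_measurable => // i _.
  apply: eq_integral => w _; congr (_%:E).
  rewrite [RHS]indicE.
  case: (pselect ((\bigcap_(i in [set` J]) (Z i @^-1` B i)) w)) => H;
    [rewrite (mem_set H)|rewrite (memNset H)].
    rewrite big1// => i _; rewrite indicE mem_set//.
    by apply: H; rewrite /= inJ.
  have /existsNP[i /not_implyP[]] : ~ (forall i, [set` J] i -> (Z i @^-1` B i) w).
    exact: H.
  rewrite /= inJ => iltn nB.
  by rewrite (bigD1 (Ordinal iltn))//= indicE memNset// mul0r.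
rewrite Z_indep// (_ : \prod_(i <- J) _ = \prod_(i < n) P (Z i @^-1` B i)).
  rewrite -prodEFin; apply: eq_bigr => i _; rewrite fineK//.
  exact: fin_num_measure.
rewrite -(big_mkord xpredT (fun i => P (Z i @^-1` B i))) /index_iota subn0.
by apply: perm_big; apply: uniq_perm; rewrite ?fset_uniq ?iota_uniq// => i;
  rewrite inJ mem_iota add0n.
Qed.

(* The indicators of the product rule are replaced by the functions [g i] one
   index [k] at a time. *)
Lemma independent_integral_prod (n : nat) (g : nat -> R -> R) (m : nat -> R) :
  (forall i, measurable_fun setT (g i)) -> (forall i x, 0 <= g i x)%R ->
  (forall i, \int[P]_w (g i (Z i w))%:E = (m i)%:E) ->
  \int[P]_w (\prod_(i < n) g i (Z i w))%:E = (\prod_(i < n) m i)%:E.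
Proof.
move=> mg g0 gm.
pose factor k (B : nat -> set R) i := if (i < k)%N then g i else \1_(B i).
pose mean k (B : nat -> set R) i :=
  if (i < k)%N then m i else fine (P (Z i @^-1` B i)).
have mfactor k B i : (forall i, measurable (B i)) -> measurable_fun setT (factor k B i).
  by move=> mB; rewrite /factor; case: ifP => // _; exact: measurable_indic.
have factor0 k B i x : (0 <= factor k B i x)%R.
  by rewrite /factor; case: ifP.
(* [B] stays quantified because the step at [k] uses the induction hypothesis with [B k] replaced by
   an arbitrary test set [A]. *)
suff H k : (k <= n)%N -> forall B, (forall i, measurable (B i)) ->
    \int[P]_w (\prod_(i < n) factor k B i (Z i w))%:E =
    (\prod_(i < n) mean k B i)%:E.
  have := H n (leqnn n) (fun=> setT) (fun=> measurableT).
  under eq_integral do under eq_bigr do rewrite /factor ltn_ord.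
  by under [in X in _ = X -> _]eq_bigr do rewrite /mean ltn_ord.
elim: k => [_ B mB|k IH kn B mB]; first exact: indep_indic.
pose k' := Ordinal kn.
pose Y w := (\prod_(i < n | i != k') factor k.+1 B i (Z i w))%R.
pose c := (\prod_(i < n | i != k') mean k.+1 B i)%R.
have neqk (i : 'I_n) : i != k' -> (i < k.+1)%N = (i < k)%N.
  by rewrite -val_eqE /= ltnS leq_eqVlt => /negbTE ->.
transitivity (\int[P]_w (Y w * g k (Z k w))%:E).
  apply: eq_integral => w _; congr (_%:E).
  by rewrite (bigD1 k')//= mulrC /factor ltnSn.
rewrite (@ge0_integral_comp_weight _ _ _ _ _ P (distribution P (Z k)) _ _ c)//.
- rewrite ge0_integral_distribution//; last 2 first.
  + exact/measurable_EFinP.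
  + by move=> y; rewrite lee_fin.
  rewrite [X in _ * X]gm -EFinM; congr (_%:E).
  by rewrite [in RHS](bigD1 k')//= mulrC /mean ltnSn.
- rewrite /Y; under eq_fun do rewrite -big_filter.
  apply: measurable_prod => i _.
  by apply: measurableT_comp => //; exact: mfactor.
- by move=> w; apply: prodr_ge0.
move=> A mA.
(* The induction hypothesis for [B'] is exactly the indicator identity that
   [ge0_integral_comp_weight] requires of the weight [Y]. *)
pose B' i := if i == k then A else B i.
have B'k : B' k = A by rewrite /B' eqxx.
have mB' i : measurable (B' i) by rewrite /B'; case: ifP.
have := IH (ltnW kn) B' mB'; rewrite (bigD1 k')//= {1}/mean ltnn B'k => E.
transitivity (\int[P]_w (\prod_(i < n) factor k B' i (Z i w))%:E).
  apply: eq_integral => w _; congr (_%:E).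
  rewrite [RHS](bigD1 k')//= mulrC {1}/factor ltnn B'k; congr (_ * _)%R.
  apply: eq_bigr => i ik; rewrite /factor neqk//; case: ifP => //.
  by rewrite /B' -[k]/(val k') val_eqE (negbTE ik).
rewrite E EFinM muleC fineK; last first.
  by apply: fin_num_measure; exact: measurable_sfunP.
congr (_%:E * _); apply: eq_bigr => i ik; rewrite /mean neqk//; case: ifP => //.
by rewrite /B' -[k]/(val k') val_eqE (negbTE ik).
Qed.

End Independence.

(** * The fourth moment of the normal law *)

Section Gaussian.
Context {R : realType}.
Notation mu := (@lebesgue_measure R).
Notation pdf := (@normal_pdf R 0 1).

Let pdfE x : pdf x = normal_peak 1 * expR (- x ^+ 2 / 2).
Proof. by rewrite normal_pdfE// /normal_fun subr0 expr1n. Qed.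

Let is_derive_pdf (x : R) : is_derive x 1 pdf (- x * pdf x).
Proof.
have -> : pdf = (fun x => normal_peak 1 * expR (- x ^+ 2 / 2)).
  by apply/funext => y; exact: pdfE.
apply: is_derive_eq.
rewrite /GRing.scale /=; lra.
Qed.

Lemma ge0_integral_normal_prob (g : R -> R) :
  measurable_fun setT g -> (forall x, 0 <= g x) ->
  (\int[normal_prob 0 1]_x (g x)%:E = \int[mu]_x (pdf x * g x)%:E)%E.
Proof.
move=> mg g0.
rewrite (@ge0_integral_comp_weight _ _ _ _ _ mu (normal_prob 0 1) id pdf 1)//.
- by rewrite mul1e.
- exact: measurable_normal_pdf.
- by move=> x; exact: normal_pdf_ge0.
move=> B mB; rewrite mul1e /normal_prob [RHS]integral_mkcond/=.
by apply: eq_integral => x _; rewrite restrict_EFin /= patchE indicE;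
  case: ifP => _; rewrite ?mulr1 ?mulr0.
Qed.

Let q (x : R) : R := (x ^+ 2 - 1) ^+ 2.
Let F (x : R) : R := - (x ^+ 3 + x) * pdf x.
Let f (x : R) : R := pdf x * q x - 2 * pdf x.

(* [q * pdf - 2 * pdf] has the primitive [F], which is nonpositive at [M] and
   nonnegative at [- M]. *)
Let is_derive_F (x : R) : is_derive x 1 F (f x).
Proof.
have dp := is_derive_pdf x; rewrite /F; apply: is_derive_eq.
rewrite /GRing.scale /= /f /q.
ring.
Qed.

Let continuous_q : continuous q.
Proof.
move=> x; apply: differentiable_continuous; apply/derivable1_diffP.
exact: ex_derive.
Qed.

Let continuous_f : continuous f.
Proof.
move=> x; have cp := @continuous_normal_pdf R 0 1 (oner_neq0 _) x.
by apply: cvgB; apply: cvgM => //; [exact: continuous_q|exact: cvg_cst].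
Qed.

Let measurable_q : measurable_fun setT q.
Proof. exact: continuous_measurable_fun. Qed.

(** On [[- M, M]] the integral of [pdf * q] is [F M - F (- M)], at most 0, plus twice the normal
    mass of the interval, at most 2. The bound survives the monotone limit in [M]. *)
Lemma normal_integral_sqr_sqrB1_le2 :
  (\int[normal_prob 0 1]_x ((x ^+ 2 - 1) ^+ 2)%:E <= 2%:E :> \bar R)%E.
Proof.
rewrite (@ge0_integral_normal_prob q)//; last by move=> x; exact: sqr_ge0.
have mpq : measurable_fun setT (fun x => (pdf x * q x)%:E).
  by apply/measurable_EFinP/measurable_funM => //; exact: measurable_normal_pdf.
have pq0 x : (0 <= (pdf x * q x)%:E)%E.
  by rewrite lee_fin mulr_ge0 ?normal_pdf_ge0 ?sqr_ge0.
(* The radius [n.+1] keeps the endpoints distinct at [n = 0], as the fundamental theorem of calculus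
   needs. *)
pose I n : set R := `[- n.+1%:R, n.+1%:R]%classic.
have IT : \bigcup_n I n = [set: R].
  apply/seteqP; split => // x _; exists (Num.truncn `|x|) => //=.
  by rewrite /I /= in_itv/= -ler_norml ltW// truncnS_gt.
have ndI : nondecreasing_seq I.
  move=> m n mn; apply/subsetPset; apply: subset_itv; rewrite bnd_simp.
    by rewrite lerN2 ler_nat.
  by rewrite ler_nat.
have mI n : measurable (I n) by exact: measurable_itv.
have cvgI := @ge0_nondecreasing_set_cvg_integral _ (measurableTypeR R) R I
  (fun x => (pdf x * q x)%:E) mu ndI mI (fun i => measurable_funTS mpq)
  (fun i x _ => pq0 x).
rewrite -IT -(cvg_lim _ cvgI)//.
apply: lime_le; first by apply/cvg_ex; eexists; exact: cvgI.
apply: nearW => n.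
set M : R := n.+1%:R.
have M0 : 0 < M by rewrite ltr0n.
have NMM : - M < M by rewrite gtrN.
have ctsF x : {for x, continuous F}.
  by apply: differentiable_continuous; apply/derivable1_diffP; exact: ex_derive.
have FTC : (\int[mu]_(x in `[(- M)%R, M]) (f x)%:E = (F M)%:E - (F (- M))%:E)%E.
  apply: continuous_FTC2 => //.
  - exact: continuous_subspaceT.
  - split => //.
    + by move=> x _; exact: ex_derive.
    + by apply: cvg_at_right_filter; exact: ctsF.
    + by apply: cvg_at_left_filter; exact: ctsF.
  - by move=> x _; rewrite derive1E; exact: derive_val.
have int_f : mu.-integrable `[(- M)%R, M] (EFin \o f).
  by apply: continuous_compact_integrable; [exact: segment_compact|exact: continuous_subspaceT].
have int_pdf : mu.-integrable `[(- M)%R, M] (fun x => (pdf x)%:E).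
  by apply: (integrableS _ _ (subsetT _)) => //; exact: integrable_normal_pdf.
rewrite (_ : (\int[mu]_(x in I n) _ =
    \int[mu]_(x in `[(- M)%R, M]) ((f x)%:E + 2%:E * (pdf x)%:E))%E); last first.
  by apply: eq_integral => x _; rewrite -EFinM -EFinD /f subrK.
rewrite integralD//; last exact: integrableZl.
rewrite FTC integralZl//.
have pdf1 : (\int[mu]_(x in `[(- M)%R, M]) (pdf x)%:E <= 1)%E.
  rewrite -(@integral_normal_pdf R 0 1); apply: ge0_subset_integral => //.
  - by apply/measurable_EFinP; exact: measurable_normal_pdf.
  - by move=> x _; rewrite lee_fin normal_pdf_ge0.
rewrite -[leRHS]add0e; apply: leeD.
  rewrite -EFinB lee_fin /F subr_le0; apply: (@le_trans _ _ 0).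
    by rewrite !mulNr oppr_le0 mulr_ge0 ?normal_pdf_ge0// addr_ge0// ?exprn_ge0// ltW.
  apply: mulr_ge0; last exact: normal_pdf_ge0.
  by rewrite exprNn -signr_odd expr1 mulN1r -opprD opprK addr_ge0// ?exprn_ge0// ltW.
by rewrite -[leRHS]mule1; apply: lee_wpmul2l; rewrite ?lee_fin.
Qed.

End Gaussian.

(** * Unconditional sums *)

#[local] Existing Instance totally_filter.

Section UnconditionalSum.
Context {I : choiceType} {K : numFieldType}.
Implicit Types (f g : I -> K) (l m c : K).

(** The relational form records convergence along with the value, which the function
    [summability.sum] does not assert by itself. *)
Definition sums_to f l : Prop :=
  partial_sum (f : I -> K^o) @ totally --> (l : K^o).

Lemma partial_sumE f (A : {fset I}) :
  partial_sum (f : I -> K^o) A = \sum_(i <- A) f i.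
Proof. by rewrite /partial_sum -(big_seq_fsetE _ _ xpredT f). Qed.

Lemma sums_toP f l : sums_to f l <->
  forall e, 0 < e -> exists A : {fset I}, forall B : {fset I},
    (A `<=` B)%fset -> `|l - \sum_(i <- B) f i| < e.
Proof.
split=> [/cvgrPdist_lt fl e e0|fl].
  have [A _ AP] := fl e e0; exists A => B AB.
  by rewrite -partial_sumE; exact: AP.
apply/cvgrPdist_lt => e e0; have [A AP] := fl e e0.
by exists A => // B /= AB; rewrite partial_sumE; exact: AP.
Qed.

Lemma sums_to_sum f l : sums_to f l -> summability.sum (f : I -> K^o) = l.
Proof. by move=> fl; apply: cvg_lim. Qed.

Lemma sums_to_unique f l m : sums_to f l -> sums_to f m -> l = m.
Proof. by move=> /sums_to_sum <- /sums_to_sum. Qed.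

Lemma sums_toD f g l m :
  sums_to f l -> sums_to g m -> sums_to (fun i => f i + g i) (l + m).
Proof.
move=> fl gm; rewrite /sums_to.
rewrite (_ : partial_sum _ = partial_sum (f : I -> K^o) \+ partial_sum (g : I -> K^o)).
  exact: cvgD.
by apply/funext => A /=; rewrite /partial_sum big_split.
Qed.

Lemma sums_toZ c f l : sums_to f l -> sums_to (fun i => c * f i) (c * l).
Proof.
move=> fl; rewrite /sums_to.
rewrite (_ : partial_sum _ = fun A => c *: partial_sum (f : I -> K^o) A).
  exact: cvgZr.
by apply/funext => A /=; rewrite /partial_sum scaler_sumr.
Qed.

Lemma sums_to_reindex (h h' : I -> I) f l : cancel h h' -> cancel h' h ->
  sums_to f l -> sums_to (fun i => f (h i)) l.
Proof.
move=> hK h'K /sums_toP fl; apply/sums_toP => e /fl[A AP].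
(* The new threshold set is the preimage of [A] under [h]. *)
exists [fset h' i | i in A]%fset => B /fsubsetP AB.
have -> : \sum_(i <- B) f (h i) = \sum_(i <- [fset h i | i in B]%fset) f i.
  rewrite big_imfset//= => x y _ _ /(congr1 h'); by rewrite !hK.
apply: AP; apply/fsubsetP => i iA; apply/imfsetP; exists (h' i) => //=.
by apply: AB; apply/imfsetP; exists i.
Qed.

Lemma sums_to_fin_supp f (A : {fset I}) : (forall i, i \notin A -> f i = 0) ->
  sums_to f (\sum_(i <- A) f i).
Proof.
move=> fA; apply/sums_toP => e e0; exists A => B AB.
suff -> : \sum_(i <- B) f i = \sum_(i <- A) f i by rewrite subrr normr0.
rewrite (bigID (mem A))/= [X in _ + X]big1 ?addr0; last exact: fA.
rewrite -big_filter; apply: perm_big.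
apply: uniq_perm; rewrite ?filter_uniq// => i.
by rewrite mem_filter/=; case: (boolP (i \in A)) => //= /(fsubsetP AB).
Qed.

End UnconditionalSum.

Section AbsoluteSummability.
Context {I : choiceType} {R : realType}.
Implicit Types f g : I -> R.

Definition abs_sum_le f (M : R) : Prop :=
  forall s : seq I, uniq s -> \sum_(i <- s) `|f i| <= M.

Lemma ler_sum_subseq f (s t : seq I) : (forall i, 0 <= f i) -> uniq s -> uniq t ->
  {subset s <= t} -> \sum_(i <- s) f i <= \sum_(i <- t) f i.
Proof.
move=> f0 us ut st.
rewrite [leRHS](bigID (mem s))/= -[leLHS]addr0.
apply: lerD; last by apply: sumr_ge0.
rewrite -[leRHS]big_filter le_eqVlt; apply/orP; left; apply/eqP; apply: perm_big.
apply: uniq_perm; rewrite ?filter_uniq// => i.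
by rewrite mem_filter/=; case: (boolP (i \in s)) => //= /st ->.
Qed.

(** The sum is the supremum of the finite partial sums: once one of them is within [e] of it, all
    larger ones are too. *)
Lemma ge0_sums_to f (M : R) : (forall i, 0 <= f i) -> abs_sum_le f M ->
  exists l, sums_to f l.
Proof.
move=> f0 fM; pose S := [set x : R | exists A : {fset I}, x = \sum_(i <- A) f i].
have hS : has_sup S.
  split; first by exists 0, fset0; rewrite big_seq_fset0.
  exists M => _ [A ->]; apply: le_trans (fM A (fset_uniq A)).
  by apply: ler_sum => i _; exact: ler_norm.
exists (sup S); apply/sums_toP => e e0.
have [_ [A ->] AS] := sup_adherent e0 hS.
exists A => B AB; rewrite ger0_norm ?subr_ge0; last first.
  by apply: sup_upper_bound => //; exists B.
rewrite ltrBlDr -ltrBlDl (lt_le_trans AS)//.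
by apply: ler_sum_subseq => //; exact/fsubsetP.
Qed.

(** Write [f] as the difference of the nonnegative families [f + |f|] and [|f|]. *)
Lemma abs_sums_to f (M : R) : abs_sum_le f M -> exists l, sums_to f l.
Proof.
move=> fM.
have M0 : 0 <= M by have := fM [::] isT; rewrite big_nil.
have pos : abs_sum_le (fun i => f i + `|f i|) (2 * M).
  move=> s us; apply: (@le_trans _ _ (\sum_(i <- s) 2 * `|f i|)).
    by apply: ler_sum => i _; rewrite (le_trans (ler_normD _ _))// normr_id; lra.
  by rewrite -mulr_sumr ler_pM2l// fM.
have [l fl] : exists l, sums_to (fun i => f i + `|f i|) l.
  apply: (ge0_sums_to _ pos) => i.
  by rewrite -lerBlDr sub0r lerNl -normrN ler_norm.
have [m fm] : exists m, sums_to (fun i => `|f i|) m.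
  by apply: (@ge0_sums_to _ M) => // s us; under eq_bigr do rewrite normr_id; exact: fM.
exists (l + -1 * m); have := sums_toD fl (sums_toZ (c := -1) fm).
rewrite (_ : (fun i => _) = f)//.
by apply/funext => i; rewrite mulN1r addrK.
Qed.

Lemma complex_sums_to (f : I -> R[i]) (M : R) :
  abs_sum_le (fun i => Normc.normc (f i)) M -> exists l, sums_to f l.
Proof.
move=> fM.
have Ref i : `|complex.Re (f i)| <= `|Normc.normc (f i)|.
  by case: (f i) => x y /=; rewrite [leRHS]ger0_norm ?sqrtr_ge0// -sqrtr_sqr
    ler_wsqrtr// lerDl sqr_ge0.
have Imf i : `|complex.Im (f i)| <= `|Normc.normc (f i)|.
  by case: (f i) => x y /=; rewrite [leRHS]ger0_norm ?sqrtr_ge0// -sqrtr_sqr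
    ler_wsqrtr// lerDr sqr_ge0.
have [x fx] : exists x, sums_to (fun i => complex.Re (f i)) x.
  by apply: (@abs_sums_to _ M) => s us; apply: le_trans (fM s us); exact: ler_sum.
have [y fy] : exists y, sums_to (fun i => complex.Im (f i)) y.
  by apply: (@abs_sums_to _ M) => s us; apply: le_trans (fM s us); exact: ler_sum.
exists (x +i* y); apply/sums_toP => e e0.
(* In the order of [R[i]] a positive element is real, so [e] can be halved as a real tolerance. *)
have eE : e = (complex.Re e)%:C by move: e0; rewrite ltcE /= => /andP[/eqP]; case: e => ? ? /= ->.
have e20 : 0 < complex.Re e / 2 by move: e0; rewrite eE ltcR => e0; rewrite divr_gt0.
have /sums_toP/(_ _ e20)[A AP] := fx; have /sums_toP/(_ _ e20)[B BP] := fy.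
exists (A `|` B)%fset => C; rewrite fsubUset => /andP[AC BC].
have := AP C AC; have := BP C BC.
set u := _ - _ => uE; set v := _ - _ => vE.
rewrite (_ : _ - _ = v +i* u); last first.
  apply/eqP; rewrite eq_complex /= !raddfB !raddf_sum /=.
  by rewrite !sumrN !eqxx.
rewrite eE (_ : v +i* u = v%:C + 'i%C * u%:C); last by simpc.
rewrite (le_lt_trans (ler_normD _ _))// normrM (_ : `|'i%C| = 1); last first.
  by rewrite normc_def /= expr0n expr1n add0r sqrtr1.
rewrite mul1r !normc_def /= !expr0n /= !addr0 !sqrtr_sqr -rmorphD ltcR.
lra.
Qed.

(** Adjoining an index outside [A] changes the partial sum by [f i], while both partial sums lie
    within [e / 2] of the limit. *)
Lemma abs_sum_le_small f (M e : R) : (forall i, 0 <= f i) -> abs_sum_le f M ->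
  0 < e -> exists A : {fset I}, forall i, i \notin A -> f i < e.
Proof.
move=> f0 fM e0; have [l /sums_toP fl] := ge0_sums_to f0 fM.
have [A AP] := fl (e / 2) (divr_gt0 e0 (ltr0Sn R 1)).
exists A => i iA.
have := AP _ (fsubset_refl A); have := AP _ (fsubsetU1 i A).
rewrite big_fsetU1//= !ltr_norml => /andP[? ?] /andP[? ?]; lra.
Qed.

End AbsoluteSummability.

(** * Summability of the solution *)

Section Resolvent.
Context {R : realType}.
Implicit Types (U V F : grid_fun R) (M : R).

Definition l1_le U M : Prop := abs_sum_le (fun p : int * int => U p.1 p.2) M.

Lemma in_l2_abs_sum_le V : in_l2 V ->
  exists M, abs_sum_le (fun p : int * int => V p.1 p.2 ^+ 2) M.
Proof.
move=> V2; exists (fine (\esum_(p in [set: int * int]) ((V p.1 p.2) ^+ 2)%:E)) => s us.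
have E0 : (0 <= \esum_(p in [set: int * int]) ((V p.1 p.2) ^+ 2)%:E)%E.
  by apply: esum_ge0 => p _; rewrite lee_fin sqr_ge0.
rewrite -lee_fin fineK ?ge0_fin_numE//.
apply: esum_ge; exists [set` s]; first by split.
rewrite fsbig_finite/=; last exact: finite_seq.
rewrite sumEFin lee_fin [leRHS](perm_big s)/=; last first.
  apply: uniq_perm => // i; rewrite in_fset_set; last exact: finite_seq.
  by apply/idP/idP; rewrite inE.
by apply: ler_sum => p _; rewrite ger0_norm ?sqr_ge0.
Qed.

Definition box (m : nat) : seq int := [seq i%:Z - m%:Z | i <- iota 0 m.*2.+1].

Lemma mem_box (m : nat) k : (k \in box m) = (`|k| <= m%:Z).
Proof.
apply/mapP/idP => [[n]|km]; first by rewrite mem_iota => nm ->; lia.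
by exists (absz (k + m%:Z)); [rewrite mem_iota; lia|lia].
Qed.

Lemma box_uniq (m : nat) : uniq (box m).
Proof. by rewrite map_inj_uniq ?iota_uniq// => i j /addIr[]. Qed.

(** The shift trades one end term of the box, which is nonnegative, for the term just outside the
    other end. *)
Lemma box_shiftr (g : int -> R) (m : nat) : (forall k, 0 <= g k) ->
  \sum_(k <- box m) g (k + 1) <= \sum_(k <- box m) g k + g (m.+1 : int).
Proof.
move=> g0; rewrite !big_map.
rewrite -[iota 0 _]/(index_iota 0 m.*2.+1) [X in _ <= X + _]big_nat_recl// big_nat_recr//=.
rewrite (_ : (m.*2)%:Z - m%:Z + 1 = m.+1); last lia.
rewrite lerD2r (eq_bigr (fun i => g (i.+1%:Z - m%:Z))) ?lerDr// => i _.
by congr g; lia.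
Qed.

Lemma box_shiftl (g : int -> R) (m : nat) : (forall k, 0 <= g k) ->
  \sum_(k <- box m) g (k - 1) <= \sum_(k <- box m) g k + g (- (m.+1 : int)).
Proof.
move=> g0; rewrite !big_map.
rewrite -[iota 0 _]/(index_iota 0 m.*2.+1) [X in _ <= X + _]big_nat_recr// big_nat_recl//=.
rewrite (_ : 0%:Z - m%:Z - 1 = - m.+1%:Z); last lia.
rewrite [leLHS]addrC lerD2r (eq_bigr (fun i => g (i%:Z - m%:Z))) ?lerDl// => i _.
by congr g; lia.
Qed.

(* Summed over a box, each off-diagonal term is at most the sum of |V| over the
   box plus a boundary term, which vanishes as the box grows. *)
Lemma l1_le_resolvent (b M : R) V F : 0 <= b -> in_l2 V -> l1_le F M ->
  (forall j k, (1 + 2 * b) * V j k - b * (V j (k + 1) + V j (k - 1)) = F j k) ->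
  l1_le V M.
Proof.
move=> b0 /in_l2_abs_sum_le[L V2] FM eqV s us.
(* The equation couples neighbours in [k] only, so the estimate is made row by row over the finitely
   many rows that [s] meets. *)
pose J := undup (map fst s).
apply/ler_addgt0Pr => e e0.
pose n : R := (size J)%:R.
have n0 : 0 <= n by [].
(* Each of the [n] rows costs a boundary error [2 * b * e']; this choice keeps the total below
   [e]. *)
pose e' := e / (1 + 2 * b * n).
have den0 : 0 < 1 + 2 * b * n by rewrite ltr_pwDl// mulr_ge0// mulr_ge0.
have e'0 : 0 < e' by rewrite divr_gt0.
have [A AP] : exists A : {fset int * int}, forall p, p \notin A -> V p.1 p.2 ^+ 2 < e' ^+ 2.
  apply: (@abs_sum_le_small _ _ _ L) => // [p|]; first exact: sqr_ge0.
  by rewrite exprn_gt0.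
(* Square summability bounds [|V|] by [e'] off the finite set [A]. The height [K] covers both [A]
   and [s], so the terms just outside the box are small. *)
pose K : nat := (\max_(p <- enum_fset A) `|p.2| + \max_(p <- s) `|p.2|)%N.
have bd p : p \notin A -> `|V p.1 p.2| <= e'.
  by move=> /AP /ltW; rewrite -real_normK ?num_real// ler_pXn2r// nnegrE ltW.
have outA j k : (K < `|k|)%N -> `|V j k| <= e'.
  move=> Kk; apply: (bd (j, k)); apply/negP => jkA.
  have : (`|k| <= \max_(p <- enum_fset A) `|p.2|)%N.
    by apply: (@leq_bigmax_seq _ _ xpredT (fun p : int * int => `|p.2|%N) (j, k)).
  move: Kk; rewrite /K; lia.
have row j : (1 + 2 * b) * (\sum_(k <- box K) `|V j k|) <=
    \sum_(k <- box K) `|F j k| + b * (2 * (\sum_(k <- box K) `|V j k|) + 2 * e').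
  apply: (@le_trans _ _ (\sum_(k <- box K) `|F j k| +
     b * (\sum_(k <- box K) `|V j (k + 1)| + \sum_(k <- box K) `|V j (k - 1)|))).
    rewrite -big_split/= !mulr_sumr -big_split/=; apply: ler_sum => k _.
    have -> : (1 + 2 * b) * `|V j k| = `|(1 + 2 * b) * V j k|.
      by rewrite normrM ger0_norm// addr_ge0// mulr_ge0.
    rewrite (_ : (1 + 2 * b) * V j k = F j k + b * (V j (k + 1) + V j (k - 1))); last first.
      by rewrite -eqV subrK.
    rewrite (le_trans (ler_normD _ _))// lerD2l normrM ger0_norm//.
    by rewrite ler_wpM2l// ler_normD.
  rewrite lerD2l ler_wpM2l//.
  have := @box_shiftr (fun k => `|V j k|) K (fun k => normr_ge0 _).
  have := @box_shiftl (fun k => `|V j k|) K (fun k => normr_ge0 _).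
  have := @outA j (K.+1 : int) _; have := @outA j (- (K.+1 : int)) _.
  rewrite abszN /= ltnSn => /(_ isT) ? /(_ isT) ? /=; lra.
(* In [row] the term [2 * b] times the sum of [|V|] cancels from both sides; this is the diagonal
   dominance of the implicit operator. *)
have rows : \sum_(j <- J) \sum_(k <- box K) `|V j k| <=
    \sum_(j <- J) \sum_(k <- box K) `|F j k| + 2 * b * n * e'.
  have -> : 2 * b * n * e' = \sum_(j <- J) (2 * b * e').
    by rewrite big_const_seq count_predT iter_addr_0 -mulr_natr -/n; ring.
  rewrite -big_split/=; apply: ler_sum => j _; have := row j; lra.
have pairs (G : grid_fun R) : \sum_(j <- J) \sum_(k <- box K) `|G j k| =
    \sum_(p <- [seq (j, k) | j <- J, k <- box K]) `|G p.1 p.2|.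
  by rewrite big_allpairs.
have pairs_uniq : uniq [seq (j, k) | j <- J, k <- box K].
  by apply: allpairs_uniq => [||[? ?] [? ?]//]; [exact: undup_uniq|exact: box_uniq].
have boxF : \sum_(j <- J) \sum_(k <- box K) `|F j k| <= M.
  by rewrite pairs; exact: FM.
have boxV : \sum_(p <- s) `|V p.1 p.2| <= \sum_(j <- J) \sum_(k <- box K) `|V j k|.
  rewrite pairs; apply: (@ler_sum_subseq _ _ (fun p => `|V p.1 p.2|)) => // p ps.
  apply/allpairsP; exists p; split; last by case: (p).
    by rewrite mem_undup map_f.
  rewrite mem_box.
  have : (`|p.2| <= K)%N.
    apply: leq_trans (leq_addl _ _).
    exact: (@leq_bigmax_seq _ _ xpredT (fun p : int * int => `|p.2|%N) p).
  by rewrite -abszE lez_nat.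
apply: (le_trans boxV); apply: (le_trans rows); apply: lerD => //.
by rewrite /e' mulrA ler_pdivrMr// mulrC ler_pM2l// lerDr.
Qed.

End Resolvent.

(** * Fourier sums of grid functions *)

Section Cis.
Context {R : realType}.
Implicit Types s t : R.

Lemma cisD s t : cis (s + t) = cis s * cis t :> R[i].
Proof. by rewrite /cis sinD cosD; simpc; congr (_ +i* _); ring. Qed.

Lemma cis0 : cis 0 = 1 :> R[i].
Proof. by rewrite /cis sin0 cos0. Qed.

Lemma normc_cis t : Normc.normc (cis t) = 1.
Proof. by rewrite /= cos2Dsin2 sqrtr1. Qed.

Lemma cis_add_cisN t : cis t + cis (- t) = (2 * cos t)%:C :> R[i].
Proof. by rewrite /cis cosN sinN; simpc; congr (_ +i* _); ring. Qed.

Lemma cis_sub_cisN t : cis t - cis (- t) = 0 +i* (2 * sin t) :> R[i].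
Proof. by rewrite /cis cosN sinN; simpc; congr (_ +i* _); ring. Qed.

End Cis.

Section L1.
Context {R : realType}.
Implicit Types U V : grid_fun R.

(** This class is propagated through the scheme because it makes the unconditional Fourier sums
    converge at every frequency. *)
Definition in_l1 U : Prop := exists M, l1_le U M.

Lemma in_l1D U V : in_l1 U -> in_l1 V -> in_l1 (fun j k => U j k + V j k).
Proof.
move=> [M UM] [N VN]; exists (M + N) => s us.
apply: le_trans (lerD (UM s us) (VN s us)).
by rewrite -big_split; apply: ler_sum => p _; exact: ler_normD.
Qed.

Lemma in_l1Z c U : in_l1 U -> in_l1 (fun j k => c * U j k).
Proof.
move=> [M UM]; exists (`|c| * M) => s us.
under eq_bigr do rewrite normrM.
by rewrite -mulr_sumr ler_wpM2l// UM.
Qed.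

Lemma in_l1_reindex (h : int * int -> int * int) U : injective h -> in_l1 U ->
  in_l1 (fun j k => U (h (j, k)).1 (h (j, k)).2).
Proof.
move=> hinj [M UM]; exists M => s us.
have := UM (map h s); rewrite map_inj_uniq// big_map => /(_ us).
by under eq_bigr do [rewrite [X in h X]surjective_pairing].
Qed.

Lemma in_l1_Dv hv U : in_l1 U -> in_l1 (Dv hv U).
Proof.
move=> U1.
have T (m : int) : in_l1 (fun j k => U j (k + m)).
  apply: (@in_l1_reindex (fun p => (p.1, p.2 + m))) => //.
  by move=> [? ?] [? ?] /= [-> /addIr ->].
have := in_l1Z (2 * hv)^-1 (in_l1D (T 1) (in_l1Z (-1) (T (-1)))).
rewrite (_ : (fun j k : int => _) = Dv hv U)//.
by apply/funext => j; apply/funext => k; rewrite /Dv mulN1r mulrC.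
Qed.

End L1.

Section FourierSum.
Context {R : realType}.
Variables (hx hv delta : R) (j0 k0 : int).
Hypothesis hxE : hx = delta * hv.
Implicit Types (U V : grid_fun R) (xi eta : R).

Definition phase xi eta (p : int * int) : R[i] :=
  cis (- ((p.1 - j0)%:~R * hx * xi + (p.2 - k0)%:~R * hv * eta)).

Definition fourier U xi eta (u : R[i]) : Prop :=
  sums_to (fun p => (U p.1 p.2)%:C * phase xi eta p) u.

Lemma fourier_exists U xi eta : in_l1 U -> exists u, fourier U xi eta u.
Proof.
move=> [M UM]; apply: (@complex_sums_to _ _ _ M) => s us.
apply: le_trans (UM s us); apply: ler_sum => p _.
by rewrite Normc.normcM normc_cis mulr1 /= expr0n addr0 sqrtr_sqr normr_id.
Qed.

Lemma UhatE U xi eta u : fourier U xi eta u ->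
  Uhat hx hv j0 k0 U xi eta = (hx * hv)%:C * u.
Proof. by move=> /sums_to_sum Uu; rewrite /Uhat Uu. Qed.

Lemma fourierD U V xi eta u v : fourier U xi eta u -> fourier V xi eta v ->
  fourier (fun j k => U j k + V j k) xi eta (u + v).
Proof.
move=> Uu Vv; have := sums_toD Uu Vv.
rewrite /fourier; congr sums_to; apply/funext => p.
by rewrite rmorphD mulrDl.
Qed.

Lemma fourierZ c U xi eta u : fourier U xi eta u ->
  fourier (fun j k => c * U j k) xi eta (c%:C * u).
Proof.
move=> Uu; have := sums_toZ (c := c%:C) Uu.
rewrite /fourier; congr sums_to; apply/funext => p.
by rewrite rmorphM mulrA.
Qed.

Lemma fourier_translate (m : int) U xi eta u : fourier U xi eta u ->
  fourier (fun j k => U j (k + m)) xi eta (cis (m%:~R * hv * eta) * u).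
Proof.
move=> Uu; pose h (m : int) (p : int * int) := (p.1, p.2 + m).
have hK : cancel (h m) (h (- m)) by move=> [? ?]; rewrite /h /= addrK.
have h'K : cancel (h (- m)) (h m) by move=> [? ?]; rewrite /h /= subrK.
have := sums_toZ (c := cis (m%:~R * hv * eta)) (sums_to_reindex hK h'K Uu).
rewrite /fourier; congr sums_to; apply/funext => p /=.
rewrite mulrCA; congr (_ * _); rewrite /phase -cisD; congr cis.
by rewrite /= !rmorphB !rmorphD /=; ring.
Qed.

(** Substituting [j + k] for [j] turns [eta] into [eta - delta * xi], since [hx = delta * hv]. The
    unimodular factor appears because phases are centred at [k0]. *)
Lemma fourier_shift V xi eta v : fourier V xi (eta - delta * xi) v ->
  fourier (Defs.shift V) xi eta (cis (k0%:~R * hx * xi) * v).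
Proof.
move=> Vv; pose h (p : int * int) := (p.1 + p.2, p.2).
pose h' (p : int * int) := (p.1 - p.2, p.2).
have hK : cancel h h' by move=> [? ?]; rewrite /h /h' /= addrK.
have h'K : cancel h' h by move=> [? ?]; rewrite /h /h' /= subrK.
have := sums_toZ (c := cis (k0%:~R * hx * xi)) (sums_to_reindex hK h'K Vv).
rewrite /fourier; congr sums_to; apply/funext => p /=.
rewrite /Defs.shift mulrCA; congr (_ * _); rewrite /phase -cisD; congr cis.
by rewrite /= !rmorphB !rmorphD /= hxE; ring.
Qed.

Lemma fourier_Dv U xi eta u : fourier U xi eta u ->
  fourier (Dv hv U) xi eta ((0 +i* (sin (hv * eta) / hv)) * u).
Proof.
move=> Uu.
have := fourierZ (c := (2 * hv)^-1) (fourierD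
  (fourier_translate (m := 1) Uu)
  (fourierZ (c := -1) (fourier_translate (m := -1) Uu))).
rewrite (_ : (fun j k : int => _) = Dv hv U); last first.
  by apply/funext => j; apply/funext => k; rewrite /Dv mulN1r mulrC.
congr fourier.
rewrite rmorphN mulN1r -mulrBl mulrA; congr (_ * _).
rewrite rmorphN1 mul1r mulN1r mulNr cis_sub_cisN.
simpc; congr (_ +i* _).
by rewrite invfM mulrACA mulVf ?pnatr_eq0// mul1r mulrC.
Qed.

Lemma fourier_Dvv U xi eta u : fourier U xi eta u ->
  fourier (Dvv hv U) xi eta (((2 * cos (hv * eta) - 2) / hv ^+ 2)%:C * u).
Proof.
move=> Uu.
have := fourierZ (c := (hv ^+ 2)^-1) (fourierD (fourierD
  (fourier_translate (m := 1) Uu) (fourierZ (c := -2) Uu))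
  (fourier_translate (m := -1) Uu)).
rewrite (_ : (fun j k : int => _) = Dvv hv U); last first.
  by apply/funext => j; apply/funext => k; rewrite /Dvv mulNr mulrC.
congr fourier.
rewrite rmorphN1 mul1r mulN1r mulNr -!mulrDl addrAC cis_add_cisN mulrA; congr (_ * _).
by rewrite -rmorphD -rmorphM mulrC.
Qed.

Lemma fourier_dirac xi eta :
  fourier (discrete_dirac hx hv j0 k0) xi eta (hx^-1 * hv^-1)%:C.
Proof.
have := @sums_to_fin_supp _ _
  (fun p => (discrete_dirac hx hv j0 k0 p.1 p.2)%:C * phase xi eta p)
  [fset (j0, k0)]%fset.
rewrite big_seq_fset1 /discrete_dirac /phase /= !eqxx !subrr !mul0r addr0 oppr0 cis0 mulr1.
apply => -[j k]; rewrite !inE xpair_eqE /= => /negbTE ->.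
by rewrite mul0r.
Qed.

End FourierSum.

(** * One step of the scheme *)

Section Step.
Context {R : realType}.
Variables (a sigma delta hx hv : R) (j0 k0 : int).
Hypotheses (a_gt0 : 0 < a) (delta_gt0 : 0 < delta) (hv_gt0 : 0 < hv).
Hypothesis hxE : hx = delta * hv.
Implicit Types U V : grid_fun R.

(** Undoing the shear turns the step into the resolvent equation of [l1_le_resolvent], whose
    right-hand side is the explicit part [G] evaluated at [(j - k, k)]. *)
Lemma in_l1_step z U V : in_l1 U -> in_l2 V ->
  milstein_step a sigma delta hv z U V -> in_l1 V.
Proof.
move=> U1 V2 UV.
pose G : grid_fun R := fun j k => U j k + (Num.sqrt delta * z * sigma * Dv hv U j k +
  delta / 2 * (z ^+ 2 - 1) * sigma ^+ 2 * Dv hv (Dv hv U) j k).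
have G1 : in_l1 G.
  apply: in_l1D => //; apply: in_l1D; apply: in_l1Z; apply: in_l1_Dv => //.
  exact: in_l1_Dv.
have : in_l1 (fun j k => G (j - k) k).
  apply: (@in_l1_reindex _ (fun p => (p.1 - p.2, p.2))) G1.
  by move=> [? ?] [? ?] /= [+ e2]; rewrite e2 => /addIr ->.
move=> [M FM]; exists M.
(* The off-diagonal coefficient of [I - (delta / 2) K1], up to sign. *)
pose b := delta * a / (2 * hv ^+ 2).
have b0 : 0 <= b by rewrite divr_ge0// mulr_ge0// ltW// exprn_gt0.
apply: (l1_le_resolvent b0 V2 FM) => j k.
have := UV (j - k) k; rewrite /Defs.shift /K1 /K2 /K3 /Dvv subrK => VE.
transitivity (V j k - delta / 2 * (a * ((V j (k + 1) - 2 * V j k + V j (k - 1)) / hv ^+ 2))).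
  by rewrite /b; field; rewrite gt_eqF.
by rewrite {1}VE /G; ring.
Qed.

(** The Fourier symbol of [I - (delta / 2) K1] at [theta = hv * eta]. *)
Definition damping (theta : R) : R := 1 + delta * a * (1 - cos theta) / hv ^+ 2.

(** The squared modulus of the symbol of the explicit part: its real part is
    [1 - (c / 2) (z^2 - 1)], its imaginary part has square [c z^2], and the terms in [c z^2]
    cancel. *)
Definition gain (theta z : R) : R :=
  let c := delta * (sigma * sin theta / hv) ^+ 2 in
  1 + c + (c / 2) ^+ 2 * (z ^+ 2 - 1) ^+ 2.

Lemma damping_ge1 theta : 1 <= damping theta.
Proof.
rewrite /damping lerDl divr_ge0 ?sqr_ge0// mulr_ge0// ?subr_ge0 ?cos_le1//.
by rewrite mulr_ge0// ltW.
Qed.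

(** Both sides of the scheme are Fourier sums of the one grid function [shift V], hence equal by
    uniqueness. Taking moduli removes the phase [ph]. *)
Lemma fourier_step z U V xi eta u v :
  milstein_step a sigma delta hv z U V ->
  fourier hx hv j0 k0 U xi eta u -> fourier hx hv j0 k0 V xi (eta - delta * xi) v ->
  Normc.normc v ^+ 2 * damping (hv * (eta - delta * xi)) ^+ 2 =
  Normc.normc u ^+ 2 * gain (hv * eta) z.
Proof.
move=> UV Uu Vv.
set ph := cis (k0%:~R * hx * xi) : R[i].
set eta' := eta - delta * xi.
have sV := fourier_shift hxE Vv.
have sKV := fourier_shift hxE (fourierZ (c := a) (fourier_Dvv Vv)).
have DU := fourier_Dv Uu.
have DDU := fourier_Dv DU.
have := fourierD (fourierD
  (fourierD Uu (fourierZ (c := delta / 2) sKV))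
  (fourierZ (c := Num.sqrt delta * z) (fourierZ (c := sigma) DU)))
  (fourierZ (c := delta / 2 * (z ^+ 2 - 1)) (fourierZ (c := sigma ^+ 2) DDU)).
rewrite (_ : (fun j k : int => _) = Defs.shift V); last first.
  by apply/funext => j; apply/funext => k; rewrite UV.
move=> /(sums_to_unique sV); rewrite -/ph -/eta'.
set s := sin _ / hv => E.
have {}E : ph * v * (damping (hv * eta'))%:C =
    u * ((1 - delta / 2 * (z ^+ 2 - 1) * (sigma * s) ^+ 2) +i* (Num.sqrt delta * z * (sigma * s))).
  move: E; case: (ph) => p1 p2; case: (v) => v1 v2; case: (u) => u1 u2.
  rewrite /damping; simpc => -[E1 E2].
  congr (_ +i* _); apply/eqP; rewrite -subr_eq0.
    by move/eqP: E1; rewrite -subr_eq0; congr (_ == 0); field; rewrite gt_eqF.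
  by move/eqP: E2; rewrite -subr_eq0; congr (_ == 0); field; rewrite gt_eqF.
have /(congr1 (fun x => Normc.normc x ^+ 2)) := E.
rewrite !Normc.normcM normc_cis mul1r !exprMn.
rewrite [X in _ * X ^+ 2 = _]/= expr0n addr0 sqrtr_sqr real_normK ?num_real// => ->.
congr (_ * _); rewrite /= sqr_sqrtr ?addr_ge0 ?sqr_ge0//.
rewrite !exprMn sqr_sqrtr ?ltW// /gain /s; field.
by rewrite gt_eqF.
Qed.

End Step.

(** * Mean gain and decay *)

Section Gain.
Context {d : measure_display} {Omega : measurableType d} {R : realType}.
Variable P : probability Omega R.
Variables (sigma delta hv : R).
Hypothesis delta_gt0 : 0 < delta.

(** [gain] with [(z^2 - 1)^2] replaced by the bound 2 on its mean. *)
Definition mean_gain (theta : R) : R :=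
  let c := delta * (sigma * sin theta / hv) ^+ 2 in 1 + c + c ^+ 2 / 2.

Lemma gain_ge0 theta z : 0 <= gain sigma delta hv theta z.
Proof.
have c0 : 0 <= delta * (sigma * sin theta / hv) ^+ 2 by rewrite mulr_ge0 ?sqr_ge0// ltW.
by apply: addr_ge0; [exact: addr_ge0|apply: mulr_ge0; exact: sqr_ge0].
Qed.

Lemma measurable_gain theta : measurable_fun setT (gain sigma delta hv theta).
Proof.
rewrite /gain; apply: measurable_funD => //; apply: measurable_funM => //.
apply: measurable_funX; apply: measurable_funB => //.
Qed.

Lemma integral_gain (Z : {RV P >-> R}) theta : standard_normal Z ->
  exists2 m, (\int[P]_w (gain sigma delta hv theta (Z w))%:E = m%:E)%E &
             0 <= m <= mean_gain theta.
Proof.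
move=> Zn; have mZ : measurable_fun [set: Omega] Z by exact: measurable_funPT.
set c := delta * (sigma * sin theta / hv) ^+ 2.
have c0 : 0 <= c by rewrite mulr_ge0 ?sqr_ge0// ltW.
pose J := (\int[normal_prob 0 1]_x ((x ^+ 2 - 1 : R) ^+ 2)%:E)%E.
have J2 : (J <= 2%:E)%E by exact: normal_integral_sqr_sqrB1_le2.
have J0 : (0 <= J)%E by apply: integral_ge0 => x _; rewrite lee_fin sqr_ge0.
have JE : J = (fine J)%:E by rewrite fineK// ge0_fin_numE// (le_lt_trans J2)// ltry.
have fJ2 : fine J <= 2 by rewrite -lee_fin -JE.
have fJ0 : 0 <= fine J by rewrite -lee_fin -JE.
exists (1 + c + (c / 2) ^+ 2 * fine J); last first.
    apply/andP; split.
    apply: addr_ge0; first exact: addr_ge0.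
    by apply: mulr_ge0 => //; exact: sqr_ge0.
  rewrite /mean_gain -/c lerD2l.
  rewrite (_ : c ^+ 2 / 2 = (c / 2) ^+ 2 * 2); last by field.
  by rewrite ler_wpM2l ?sqr_ge0.
have mq : measurable_fun [set: R] (fun x : R => ((x ^+ 2 - 1) ^+ 2)%:E).
  by apply/measurable_EFinP; apply: measurable_funX; apply: measurable_funB.
have -> : (\int[P]_w (gain sigma delta hv theta (Z w))%:E =
    \int[normal_prob 0 1]_z (gain sigma delta hv theta z)%:E)%E.
  (* Not a change of variables: [distribution P Z] lives on [R] and [normal_prob]
     on [measurableTypeR R], which carry different displays. *)
  rewrite -[RHS]mul1e -(@ge0_integral_comp_weight _ _ Omega (measurableTypeR R) R P
    (normal_prob 0 1) Z (cst 1) 1 (gain sigma delta hv theta))//.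
  - by apply: eq_integral => w _; rewrite /= mul1r.
  - exact: measurable_gain.
  - by move=> x; exact: gain_ge0.
  - move=> B mB; rewrite mul1e -[RHS](Zn B mB) /distribution /pushforward.
    under eq_integral do rewrite /= mul1r.
    rewrite integral_indic//; first by rewrite setIT.
    exact: measurable_sfunP.
under eq_integral do rewrite /gain -/c EFinD (EFinM ((c / 2) ^+ 2)).
rewrite ge0_integralD//.
- rewrite integral_cst//= [X in (_ * X + _)%E](@integral_normal_pdf R 0 1) mule1.
  rewrite ge0_integralZl_EFin ?sqr_ge0//.
    by rewrite -/J [in LHS]JE -EFinM -EFinD.
  by move=> x _; rewrite lee_fin sqr_ge0.
- by move=> x _; rewrite lee_fin addr_ge0.
- by move=> x _; rewrite -EFinM lee_fin mulr_ge0 ?sqr_ge0.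
- exact: measurable_funeM.
Qed.

End Gain.

Section Decay.
Context {R : realType}.

(** Each pair contributes [r^2] and an unpaired factor at most 1, so [n] factors give at most
    [r^(n-1)]. The induction treats [n] and [n.+1] together, and the extra [r] on the left avoids
    the exponent [n - 1]. *)
Lemma cvg_prod_pairwise_lt1 (b : nat -> R) (r : R) : 0 < r -> r < 1 ->
  (forall m, 0 <= b m <= 1) -> (forall m, b m * b m.+1 <= r ^+ 2) ->
  (\prod_(m < n) b m) @[n --> \oo] --> (0 : R).
Proof.
move=> r0 r1 b01 br.
have b0 m : 0 <= b m by case/andP: (b01 m).
have p0 n : 0 <= \prod_(m < n) b m by exact: prodr_ge0.
have H n : (\prod_(m < n) b m) * r <= r ^+ n /\
    (\prod_(m < n.+1) b m) * r <= r ^+ n.+1.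
  elim: n => [|n [IH1 IH2]].
    rewrite big_ord0 big_ord1 expr0 expr1 mul1r; split; first exact: ltW.
    by apply: ler_piMl; [exact: ltW|case/andP: (b01 0%N)].
  split => //; rewrite (_ : _ * r = (\prod_(i < n) b i * r) * (b n * b n.+1)); last first.
    by rewrite !big_ord_recr/=; ring.
  rewrite (_ : r ^+ n.+2 = r ^+ n * r ^+ 2); last by rewrite -exprD addn2.
  by apply: ler_pM => //; rewrite mulr_ge0// ltW.
apply: (@squeeze_cvgr _ _ _ _ (fun=> 0) (fun n => r^-1 * r ^+ n)).
- apply: nearW => n; rewrite p0/= mulrC -ler_pdivrMr ?invr_gt0// invrK.
  by case: (H n).
- exact: cvg_cst.
- rewrite -[X in _ --> X](mulr0 r^-1); apply: cvgM; first exact: cvg_cst.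
  by apply: cvg_expr; rewrite ger0_norm// ltW.
Qed.

(** Twice the right side minus the left is [(cos x + cos y - 2)^2 + (sin x + sin y)^2]. *)
Lemma cosB_le (x y : R) :
  1 - cos (x - y) <= 2 * ((1 - cos x) + (1 - cos y)).
Proof.
rewrite cosB; have := cos2Dsin2 x; have := cos2Dsin2 y.
have := sqr_ge0 (cos x + cos y - 2); have := sqr_ge0 (sin x + sin y).
set cx := cos x; set cy := cos y; set sx := sin x; set sy := sin y.
nra.
Qed.

Lemma cos_lt1 (x : R) : - pi <= x <= pi -> x != 0 -> cos x < 1.
Proof.
wlog x0 : x / 0 <= x => [H xpi xn0|].
  have [x0|/ltW x0] := leP 0 x; first exact: H.
  rewrite -cosN; apply: H; rewrite ?oppr_ge0 ?oppr_eq0//.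
  by case/andP: xpi => ? ?; rewrite lerN2 lerNl; apply/andP.
move=> /andP[_ xpi] xn0; rewrite -cos0 ltr_cos ?in_itv/= ?lexx ?pi_ge0 ?x0//.
by rewrite lt_neqAle eq_sym xn0.
Qed.

Variables (a sigma delta hv : R).
Hypotheses (a_gt0 : 0 < a) (delta_gt0 : 0 < delta) (hv_gt0 : 0 < hv).
Hypotheses (sigma2_lt : sigma ^+ 2 < a) (sigma_a : 2 * sigma ^+ 4 < a ^+ 2).

(** With [A = lam * a], [S = lam * sigma^2] and [s = 1 - cos theta], one has [c = S s (2 - s)]. The
    linear terms leave a margin [2 (A - S) s], and [2 S^2 < A^2] lets [A^2 s^2] absorb [c^2 / 2].
    Since [s <= 2], the bound [kappa <= 1 / 2] makes [1 - kappa s] nonnegative. *)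
Lemma mean_gain_le : exists kappa, [/\ 0 < kappa, kappa <= 1 / 2 &
  forall theta, mean_gain sigma delta hv theta <=
    (1 - kappa * (1 - cos theta)) * damping a delta hv theta ^+ 2].
Proof.
pose lam := delta / hv ^+ 2.
have lam0 : 0 < lam by rewrite divr_gt0// exprn_gt0.
have la0 : 0 < lam * a by rewrite mulr_gt0.
have ls0 : 0 <= lam * sigma ^+ 2 by rewrite mulr_ge0 ?sqr_ge0// ltW.
have lsa : lam * sigma ^+ 2 < lam * a by rewrite ltr_pM2l.
have lsa2 : 2 * (lam * sigma ^+ 2) ^+ 2 < (lam * a) ^+ 2.
  rewrite (_ : 2 * _ = lam ^+ 2 * (2 * sigma ^+ 4)); last by ring.
  by rewrite [ltRHS]exprMn ltr_pM2l ?exprn_gt0.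
(* The largest squared damping, reached at [s = 2]; dividing the margin by it gives [kappa]. *)
pose D := (1 + 2 * (lam * a)) ^+ 2.
have D0 : 0 < D by rewrite exprn_gt0//; lra.
exists (2 * (lam * a - lam * sigma ^+ 2) / D); split.
- by rewrite divr_gt0//; lra.
- by rewrite ler_pdivrMr// /D; nra.
move=> theta.
have mgE : mean_gain sigma delta hv theta =
    1 + lam * sigma ^+ 2 * (1 - cos theta) * (1 + cos theta) +
    (lam * sigma ^+ 2 * (1 - cos theta) * (1 + cos theta)) ^+ 2 / 2.
  rewrite /mean_gain (_ : delta * _ = lam * sigma ^+ 2 * (1 - cos theta) * (1 + cos theta))//.
  rewrite -[RHS]mulrA (_ : (1 - cos theta) * (1 + cos theta) = sin theta ^+ 2); last first.
    by rewrite sin2cos2; ring.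
  by rewrite /lam; field; rewrite gt_eqF.
have dE : damping a delta hv theta = 1 + lam * a * (1 - cos theta).
  by rewrite /damping /lam; congr (1 + _); ring.
rewrite mgE dE mulrBl mul1r.
have := cos_le1 theta; have := cos_geN1 theta.
move: (cos theta) => c c1 c2.
set A := lam * a in la0 lsa lsa2 D D0 *; set S := lam * sigma ^+ 2 in ls0 lsa lsa2 *.
rewrite -[X in _ + X + _]mulrA; set s := 1 - c.
have s0 : 0 <= s by rewrite subr_ge0.
have s2 : s <= 2 by rewrite /s; lra.
rewrite (_ : 1 + c = 2 - s); last by rewrite /s; ring.
clearbody s A S.
have dD : (1 + A * s) ^+ 2 <= D.
  by rewrite /D ler_pXn2r ?nnegrE//; nra.
set k := 2 * (A - S) / D.
have k0 : 0 <= k by rewrite divr_ge0 ?ltW//; lra.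
have kb : k * s * (1 + A * s) ^+ 2 <= 2 * (A - S) * s.
  apply: (@le_trans _ _ (k * s * D)); first by rewrite ler_wpM2l// mulr_ge0.
  by rewrite /k mulrAC divfK// gt_eqF.
have quad : (S * (s * (2 - s))) ^+ 2 / 2 <= A ^+ 2 * s ^+ 2.
  have h1 : (2 - s) ^+ 2 <= 4.
    have : 0 <= s * (4 - s) by apply: mulr_ge0 => //; lra.
    lra.
  have h2 : S ^+ 2 * s ^+ 2 * (2 - s) ^+ 2 <= S ^+ 2 * s ^+ 2 * 4.
    by rewrite ler_wpM2l// mulr_ge0 ?sqr_ge0.
  have h3 : 2 * S ^+ 2 * s ^+ 2 <= A ^+ 2 * s ^+ 2.
    by rewrite ler_wpM2r ?sqr_ge0 ?ltW.
  rewrite !exprMn; lra.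
have Ss : 0 <= S * s ^+ 2 by rewrite mulr_ge0 ?sqr_ge0.
lra.
Qed.

End Decay.

(** * Mean-square stability *)

Section Scheme.
Context {R : realType}.
Variables (a sigma delta hx hv : R) (j0 k0 : int).
Hypotheses (a_gt0 : 0 < a) (delta_gt0 : 0 < delta).
Hypotheses (hv_gt0 : 0 < hv) (hx_gt0 : 0 < hx).
Hypothesis hxE : hx = delta * hv.

Lemma in_l1_dirac : in_l1 (discrete_dirac hx hv j0 k0).
Proof.
exists `|hx^-1 * hv^-1| => s us; rewrite /discrete_dirac.
have zero (p : int * int) : p != (j0, k0) ->
    `|if (p.1 == j0) && (p.2 == k0) then hx^-1 * hv^-1 else 0| = 0.
  by case: p => j k; rewrite xpair_eqE /= => /negbTE ->; rewrite normr0.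
have [ins|nins] := boolP ((j0, k0) \in s).
  rewrite (bigD1_seq (j0, k0))//= !eqxx/= big1 ?addr0// => p; exact: zero.
rewrite big_seq big1 ?normr_ge0// => p ps; apply: zero.
by apply: contraNneq nins => <-.
Qed.

Definition frequency (xi eta : R) (m : nat) : R := hv * (eta - m%:R * delta * xi).

(** Along the moving frequency [eta - n delta xi] the one-step identities chain into a product, path
    by path. *)
Lemma scheme_amplitude (z : nat -> R) (U : nat -> grid_fun R) (xi eta : R) (n : nat) :
  milstein_scheme a sigma delta hx hv j0 k0 z U ->
  Normc.normc (Uhat hx hv j0 k0 (U n) xi (eta - n%:R * delta * xi)) ^+ 2 =
  (\prod_(m < n) gain sigma delta hv (frequency xi eta m) (z m)) /
  (\prod_(m < n) damping a delta hv (frequency xi eta m.+1) ^+ 2).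
Proof.
move=> [U0 UV].
have U1 m : in_l1 (U m).
  elim: m => [|m IH]; first by rewrite U0; exact: in_l1_dirac.
  by have [V2 st] := UV m; exact: (in_l1_step a_gt0 delta_gt0 hv_gt0 IH V2 st).
have D0 m : \prod_(m < m) damping a delta hv (frequency xi eta m.+1) ^+ 2 != 0.
  apply/prodf_neq0 => i _; rewrite expf_neq0// gt_eqF//.
  by apply: lt_le_trans (damping_ge1 _ _ _ _) => //.
(* The induction carries the identity with the damping multiplied out; it starts from 1 because
   [hx * hv] normalises the Dirac mass. *)
have [u [Uu uE]] : exists u,
    fourier hx hv j0 k0 (U n) xi (eta - n%:R * delta * xi) u /\
    Normc.normc ((hx * hv)%:C * u) ^+ 2 *
      (\prod_(m < n) damping a delta hv (frequency xi eta m.+1) ^+ 2) =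
    \prod_(m < n) gain sigma delta hv (frequency xi eta m) (z m).
  elim: n => [|n [u [Uu uE]]].
    exists (hx^-1 * hv^-1)%:C; split; first by rewrite U0; exact: fourier_dirac.
    rewrite !big_ord0 mulr1 -rmorphM mulrACA !mulfV ?gt_eqF// mulr1.
    by rewrite Normc.normc1 expr1n.
  have [v Vv] := fourier_exists hx hv j0 k0 xi (eta - n.+1%:R * delta * xi) (U1 n.+1).
  exists v; split => //.
  rewrite !big_ord_recr/= -uE.
  have := fourier_step delta_gt0 hv_gt0 hxE (UV n).2 Uu.
  have -> : eta - n%:R * delta * xi - delta * xi = eta - n.+1%:R * delta * xi.
    by rewrite -natr1; ring.
  move=> /(_ v Vv) E.
  rewrite !Normc.normcM !exprMn -[hv * _]/(frequency xi eta n.+1) in E *.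
  set c := Normc.normc (hx * hv)%:C ^+ 2; set Pd := \prod_(m < n) _.
  transitivity (c * Pd * (Normc.normc v ^+ 2 * damping a delta hv (frequency xi eta n.+1) ^+ 2)).
    by ring.
  by rewrite E /frequency; ring.
by rewrite (UhatE Uu) -uE mulfK.
Qed.

End Scheme.

Theorem theorem3p1 (R : realType)
    (d : measure_display) (Omega : measurableType d) (P : probability Omega R)
    (Z : nat -> {RV P >-> R})
    (T : R) (N : nat) (delta hx hv a sigma : R) (j0 k0 : int)
    (U : nat -> Omega -> grid_fun R)
    (X : nat -> Omega -> R -> R -> R[i])
    (Z_indep : mutually_independent Z)
    (Z_normal : forall n, standard_normal (Z n))
    (T_gt0 : 0 < T) (N_ge1 : (1 <= N)%N) (deltaE : delta = T / N%:R)
    (hv_gt0 : 0 < hv) (hx_gt0 : 0 < hx) (hxE : hx = delta * hv)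
    (a_gt0 : 0 < a) (sigma_ge0 : 0 <= sigma) (sigma_lt : sigma < Num.sqrt a)
    (sigma_a : 2 * sigma ^+ 4 < a ^+ 2)
    (U_scheme : forall w, milstein_scheme a sigma delta hx hv j0 k0
                            (fun n => Z n w) (fun n => U n w))
    (X_def : forall n w (xi eta : R),
       Uhat hx hv j0 k0 (U n w) xi eta = X n w xi (eta + n%:R * delta * xi)) :
  forall xi eta : R,
    xi \in `[- (pi / hx), pi / hx] -> eta \in `[- (pi / hv), pi / hv] ->
    (xi, eta) <> (0, 0) ->
    ('E_P[fun w => (Normc.normc (X n w xi eta) ^+ 2)%R])%E @[n --> \oo] --> 0%E.
Proof.
move=> xi eta xi_in eta_in xieta_neq0.
have delta_gt0 : 0 < delta by rewrite deltaE divr_gt0// ltr0n.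
have sigma2_lt : sigma ^+ 2 < a.
  by rewrite -[ltRHS]sqr_sqrtr ?ltW// ltr_pXn2r// nnegrE ?sqrtr_ge0.
pose th := frequency delta hv xi eta.
pose D m := damping a delta hv (th m) ^+ 2.
have D_ge1 m : 1 <= D m.
  by rewrite /D exprn_ege1// damping_ge1.
have D_gt0 m : 0 < D m := lt_le_trans ltr01 (D_ge1 m).
have [mn mnE mnle] : exists2 mn : nat -> R,
    forall m, (\int[P]_w (gain sigma delta hv (th m) (Z m w))%:E = (mn m)%:E)%E &
    forall m, 0 <= mn m <= mean_gain sigma delta hv (th m).
  have H m : exists x : R, (\int[P]_w (gain sigma delta hv (th m) (Z m w))%:E = x%:E)%E /\
    0 <= x <= mean_gain sigma delta hv (th m).
    have [x ? ?] := integral_gain sigma hv delta_gt0 (th m) (Z_normal m).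
    by exists x.
  have [mn mnP] := choice H.
  by exists mn => m; case: (mnP m).
have EE n : ('E_P[fun w => (Normc.normc (X n w xi eta) ^+ 2)%R] =
    ((\prod_(m < n) mn m) / \prod_(m < n) D m.+1)%:E)%E.
  rewrite unlock.
  rewrite EFinM muleC -(independent_integral_prod Z_indep n
    (fun i => measurable_gain sigma delta hv (th i))
    (fun i => gain_ge0 sigma hv delta_gt0 (th i)) mnE).
  rewrite -ge0_integralZl_EFin//.
  - apply: eq_integral => w _; rewrite -EFinM; congr (_%:E).
    have := X_def n w xi (eta - n%:R * delta * xi); rewrite subrK => <-.
    by rewrite (scheme_amplitude a_gt0 delta_gt0 hv_gt0 hx_gt0 hxE _ _ _ (U_scheme w)) mulrC.
  - by move=> w _; rewrite lee_fin prodr_ge0// => i _; exact: gain_ge0.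
  - apply/measurable_EFinP/measurable_prod => i _.
    by apply: measurableT_comp => //; exact: measurable_gain.
  - by rewrite invr_ge0 prodr_ge0// => i _; exact: ltW.
have [kappa [kappa0 kappa2 kappaP]] := mean_gain_le a_gt0 delta_gt0 hv_gt0 sigma2_lt sigma_a.
pose s m := 1 - cos (th m).
have s0 m : 0 <= s m by rewrite subr_ge0 cos_le1.
have s2 m : s m <= 2 by rewrite /s; have := cos_geN1 (th m); lra.
pose b m := 1 - kappa * s m.
have b01 m : 0 <= b m <= 1.
  apply/andP; split; last by rewrite /b lerBlDr lerDl mulr_ge0// ltW.
  have : kappa * s m <= 1 / 2 * 2 by apply: ler_pM => //; exact: ltW.
  rewrite /b; lra.
(* If [xi = 0], every [th m] equals [hv * eta], whose cosine is below 1. Otherwise consecutive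
   angles differ by [hx * xi], nonzero in [[- pi, pi]], and [cosB_le] applies. *)
have [c0 [c00 c02 c0P]] : exists c0, [/\ 0 < c0, c0 <= 2 & forall m, c0 <= s m + s m.+1].
  have pi_itv h x : 0 < h -> x \in `[- (pi / h), pi / h] -> - pi <= h * x <= pi.
    move=> h0; rewrite in_itv/= => /andP[x1 x2].
    by rewrite mulrC -ler_pdivrMr// mulNr x1 -ler_pdivlMr.
  have [xi0|xi0] := eqVneq xi 0.
    have eta0 : eta != 0 by apply/eqP => eta0; apply: xieta_neq0; rewrite xi0 eta0.
    have lt1 : cos (hv * eta) < 1.
      by apply: cos_lt1; [exact: pi_itv|rewrite mulf_neq0// gt_eqF].
    exists (1 - cos (hv * eta)); split; rewrite ?subr_gt0//.
      by have := cos_geN1 (hv * eta); lra.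
    by move=> m; rewrite /s /th /frequency xi0 !mulr0 !subr0 lerDl subr_ge0 cos_le1.
  have lt1 : cos (hx * xi) < 1.
    by apply: cos_lt1; [exact: pi_itv|rewrite mulf_neq0// gt_eqF].
  exists ((1 - cos (hx * xi)) / 2); split.
  - by rewrite divr_gt0// subr_gt0.
  - by have := cos_geN1 (hx * xi); lra.
  move=> m; have := cosB_le (th m) (th m.+1).
  have -> : th m - th m.+1 = hx * xi by rewrite /th /frequency hxE -natr1; ring.
  rewrite /s; lra.
(* One of [s m], [s m.+1] is at least [c0 / 2], so its factor is at most [q] and the other at most
   1. *)
pose q := 1 - kappa * c0 / 2.
have kc : 0 < kappa * c0 by rewrite mulr_gt0.
have q0 : 0 < q.
  rewrite /q; have : kappa * c0 <= (1 / 2) * 2 by rewrite ler_pM// ltW.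
  lra.
have q1 : q < 1 by rewrite /q; lra.
have bq m : b m * b m.+1 <= Num.sqrt q ^+ 2.
  rewrite sqr_sqrtr; last exact: ltW.
  rewrite /q.
  have /andP[? ?] := b01 m; have /andP[? ?] := b01 m.+1; have := c0P m.
  have [ss|ss] := leP (c0 / 2) (s m) => h.
        apply: (@le_trans _ _ (b m)); first by rewrite ler_piMr.
    rewrite /b lerD2l lerN2 -mulrA ler_pM2l//.
  apply: (@le_trans _ _ (b m.+1)); first by rewrite ler_piMl.
  rewrite /b lerD2l lerN2 -mulrA ler_pM2l//; lra.
have bcvg := cvg_prod_pairwise_lt1 (r := Num.sqrt q) _ _ b01 bq.
have {}bcvg : (\prod_(m < n) b m) @[n --> \oo] --> (0 : R).
  by apply: bcvg; rewrite ?sqrtr_gt0// -sqrtr1 ltr_sqrt.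
under eq_fun do rewrite EE.
apply: cvg_EFin; first exact: nearW.
apply: (@squeeze_cvgr _ _ _ _ (fun=> 0) (fun n => D 0%N * \prod_(m < n) b m)).
- apply: nearW => n /=; apply/andP; split.
    rewrite divr_ge0 ?prodr_ge0// => i _; first by case/andP: (mnle i).
    exact: ltW.
  rewrite ler_pdivrMr ?prodr_gt0//.
  (* The implicit step damps at [th m.+1] while the gain sits at [th m]. Aligning the indices costs
     the constant [D 0] and leaves [D n], which is at least 1. *)
  have DE : D 0%N * \prod_(m < n) D m.+1 = (\prod_(m < n) D m) * D n.
    transitivity (\prod_(m < n.+1) D m); first by rewrite big_ord_recl.
    by rewrite big_ord_recr.
  rewrite mulrAC DE mulrAC -big_split/=.
  rewrite -[leLHS]mulr1; apply: ler_pM => //.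
    by apply: prodr_ge0 => i _; case/andP: (mnle i).
  apply: ler_prod => i _; case/andP: (mnle i) => -> h /=.
  by rewrite mulrC (le_trans h).
- exact: cvg_cst.
- rewrite -[X in _ --> X](mulr0 (D 0%N)); apply: cvgM => //; exact: cvg_cst.
Qed.
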